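(* Assume that: (i) the coefficients $q^k_{ij}=q^k_{ji}$, $b^k_j$ and the entries $c_{hk}$ of the not identically vanishing matrix-valued function $C$ belong to $C^{\alpha/2,\alpha}_{\rm loc}(I\times\mathbb R^d)$ for some $\alpha\in(0,1)$ and all $i,j=1,\dots,d$, $h,k=1,\dots,m$; (ii) for every $k=1,\dots,m$, the infimum $\mu^0_k$ over $I\times\mathbb R^d$ of the minimum eigenvalue $\mu_k(t,x)$ of $Q^k(t,x)=(q^k_{ij}(t,x))$ is positive; (iii) there is no nontrivial (nonempty and proper) set $K\subset\{1,\dots,m\}$ such that the coefficients $c_{ij}$ identically vanish on $I\times\mathbb R^d$ for all $i\in K$ and $j\notin K$; (iv) for every bounded $J\subset I$ there exist a function $\boldsymbol\varphi_J\in C^2(\mathbb R^d;\mathbb R^m)$ with positive components, each blowing up as $|x|\to+\infty$, and a constant $\lambda_J>0$ such that $(\boldsymbol{\mathcal A}(t)\boldsymbol\varphi_J)(x)\le\lambda_J\boldsymbol\varphi_J(x)$ for all $t\in J$, $x\in\mathbb R^d$. Assume further that the off-diagonal entries of $C$ are nonnegative and that the sum of the elements of each row of $C$ is nonpositive. Let $T>s$ with $s\in I$. If $\mathbf u\in C_b([s,T]\times\mathbb R^d;\mathbb R^m)\cap C^{1,2}((s,T]\times\mathbb R^d;\mathbb R^m)$ satisfies $$D_t\mathbf u-\boldsymbol{\mathcal A}(t)\mathbf u\le 0\ \text{ in }(s,T]\times\mathbb R^d,\qquad \mathbf u(s,\cdot)\le 0\ \text{ in }\mathbb R^d,$$ then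 $\mathbf u\le 0$ in $[s,T]\times\mathbb R^d$.
   Context: Let $d,m$ be positive integers and let $I$ be either an open right half-line or $I=\mathbb R$. For $t\in I$, $\boldsymbol{\mathcal A}(t)$ is the operator acting on smooth $\boldsymbol\psi:\mathbb R^d\to\mathbb R^m$ by $$(\boldsymbol{\mathcal A}(t)\boldsymbol\psi)_k(x)=\mathrm{Tr}(Q^k(t,x)D^2\psi_k(x))+\langle \mathbf b^k(t,x),\nabla\psi_k(x)\rangle+(C(t,x)\boldsymbol\psi(x))_k,\quad k=1,\dots,m,$$ with $Q^k=(q^k_{ij})_{i,j=1}^d$, $\mathbf b^k=(b^k_1,\dots,b^k_d)$ and $C=(c_{hk})_{h,k=1}^m$ defined on $I\times\mathbb R^d$. Inequalities between vector-valued functions are componentwise. $C_b$ denotes bounded continuous functions; $C^{1,2}$ denotes functions once continuously differentiable in $t$ and twice in $x$; $C^{\alpha/2,\alpha}_{\rm loc}$ denotes functions that are locally $\alpha/2$-Hölder in $t$ and $\alpha$-Hölder in $x$ (parabolic Hölder space on compact sets). *)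

(* Defs.v *)
From HB Require Import structures.
From mathcomp Require Import all_boot all_order all_algebra.
From mathcomp Require Import all_classical all_reals all_analysis.

Set Implicit Arguments.
Unset Strict Implicit.
Unset Printing Implicit Defensive.

Import Order.TTheory GRing.Theory Num.Theory.
Import numFieldNormedType.Exports.

Local Open Scope classical_set_scope.
Local Open Scope ring_scope.

(* Points of R^d and values in R^m are row vectors.  The library norm on
   'rV[R]_d is the sup norm; it enters only through notions (compactness,
   boundedness, local Hoelder continuity, |x| -> +oo) that are the same for the
   Euclidean norm. *)

Section TimeDerivative.
Context {R : realType}.
Implicit Types (J : set R) (f : R -> R) (t : R).

(* The increments are restricted to J, so at an endpoint of J belonging to J
   this is a one-sided derivative; in the interior of J it is the usual one. *)
Definition derivable_in J f t : Prop :=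
  cvg ((f r - f t) / (r - t) @[r --> within J t^']).

Definition derive_in J f t : R :=
  lim ((f r - f t) / (r - t) @[r --> within J t^']).

End TimeDerivative.

Section SpaceDerivatives.
Context {R : realType} {d : nat}.
Implicit Types (f : 'rV[R]_d -> R) (i j : 'I_d) (x : 'rV[R]_d).

Definition partial i f x : R := 'D_(delta_mx 0 i) f x.

Definition partial2 i j f x : R := partial i (partial j f) x.

Definition grad f x : 'rV[R]_d := \row_i partial i f x.

Definition hessian f x : 'M[R]_d := \matrix_(i, j) partial2 i j f x.

Definition has_partials2 f : Prop :=
  (forall i x, derivable f x (delta_mx 0 i)) /\
  (forall i j x, derivable (partial j f) x (delta_mx 0 i)).

Definition C2 f : Prop :=
  [/\ has_partials2 f,
      continuous f,
      forall i, continuous (partial i f)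
    & forall i j, continuous (partial2 i j f)].

End SpaceDerivatives.

Section ParabolicSpaces.
Context {R : realType} {d : nat}.
Implicit Types (J : set R) (u : R -> 'rV[R]_d -> R).

Definition C12 J u : Prop :=
  [/\ forall t x, J t -> derivable_in J (u ^~ x) t,
      forall t, J t -> has_partials2 (u t)
    & [/\ {within J `*` setT, continuous (fun z => u z.1 z.2)},
      {within J `*` setT, continuous (fun z => derive_in J (u ^~ z.2) z.1)},
      forall i, {within J `*` setT, continuous (fun z => partial i (u z.1) z.2)}
    & forall i j,
        {within J `*` setT, continuous (fun z => partial2 i j (u z.1) z.2)}]].

Definition parabolic_hoelder_loc (alpha : R) J u : Prop :=
  forall K : set (R * 'rV[R]_d), compact K -> K `<=` J `*` setT ->
  exists M : R, forall z w, K z -> K w ->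
    `|u z.1 z.2 - u w.1 w.2| <=
      M * (`|z.1 - w.1| `^ (alpha / 2) + `|z.2 - w.2| `^ alpha).

End ParabolicSpaces.

(* For a symmetric matrix of positive size the set of (real) eigenvalues is
   finite and nonempty, so its infimum is its minimum. *)
Definition min_eigenvalue {R : realType} {n : nat} (A : 'M[R]_n) : R :=
  inf [set a | eigenvalue A a].

Definition component {R : realType} {d m : nat} (k : 'I_m)
  (psi : 'rV[R]_d -> 'rV[R]_m) : 'rV[R]_d -> R := fun x => psi x 0 k.

Definition elliptic_op {R : realType} {d m : nat}
    (Q : 'I_m -> R -> 'rV[R]_d -> 'M[R]_d)
    (b : 'I_m -> R -> 'rV[R]_d -> 'rV[R]_d)
    (C : R -> 'rV[R]_d -> 'M[R]_m)
    (t : R) (psi : 'rV[R]_d -> 'rV[R]_m) : 'rV[R]_d -> 'rV[R]_m :=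
  fun x => \row_k
    (\tr (Q k t x *m hessian (component k psi) x)
     + \sum_(i < d) b k t x 0 i * grad (component k psi) x 0 i
     + \sum_(h < m) C t x k h * psi x 0 h).

Definition blows_up {R : realType} {d : nat} (f : 'rV[R]_d -> R) : Prop :=
  forall M : R, exists r : R, forall x, r <= `|x| -> M <= f x.

(* Main.v *)
Require Import Defs.
From mathcomp Require Import all_boot all_order all_algebra.
From mathcomp Require Import all_classical all_reals all_analysis.
From mathcomp Require Import ring lra.

Import Order.TTheory GRing.Theory Num.Theory.
Import numFieldNormedType.Exports.

Local Open Scope classical_set_scope.
Local Open Scope ring_scope.

(** Suppose that some component of [u] is positive at a point with time [t1].
    Take the Lyapunov function [phi] of the interval [[s, T]], with constant
    [lam], put [E t = expR ((lam + 1) * (t - s))], and perturb [u] to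
    [w = u - eps * E t * phi], where [eps > 0] is so small that [w] is still
    positive at the chosen point.  As [u] is bounded and [phi] blows up, every
    [w k] is nonpositive outside a compact cylinder, so that [w] has a positive
    global maximum, over space, time and components at once, attained at some
    [(k, t, x)].  The initial condition excludes [t = s].

    At that point three things happen.  The diffusion and drift terms of
    component [k] of [w] contribute at most [0], since the gradient vanishes, the
    Hessian is negative semidefinite and [Q] is positive definite.  So does the
    coupling: row [k] of [C] applied to [w] is at most its row sum times the
    positive maximum, because the off-diagonal entries are nonnegative.  Hence
    the operator applied to [u] is at most [eps * E t] times the operator applied
    to [phi], thus at most [eps * E t * lam * phi] ([elliptic_op_max_le]).  On the
    other hand, at [x] and at times before [t], [w k] does not exceed its value at
    [t], so the time derivative of [u] is at least that of [eps * E * phi], namely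
    [eps * E t * (lam + 1) * phi] ([derive_in_ge]).  Since [u] is a subsolution,
    [lam + 1 <= lam], a contradiction; the rate [lam + 1] of [E] is there to make
    this comparison strict.

    Two classical facts are used on the way.  A symmetric matrix
    with positive eigenvalues pairs nonpositively, under the trace, with a matrix
    of nonpositive quadratic form ([eigen_psd], [psd_trace_le0]).  A
    function whose partial derivatives exist and are continuous has derivatives
    along every direction, given by the usual formula ([is_derive_partials]);
    applied to [f] and to its partial derivatives, this reduces the second order condition at a maximum
    to functions of one real variable ([C2_max]). *)

(** * Positive semidefinite matrices *)

Definition form {R : realType} {n : nat} (A : 'M[R]_n) (x y : 'rV[R]_n) : R :=
  (x *m A *m y^T) 0 0.

Section QuadraticForms.
Context {R : realType} {n : nat}.
Implicit Types (A B Q H : 'M[R]_n) (x y v : 'rV[R]_n).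

Definition psd A : Prop := forall x, 0 <= form A x x.

Lemma formC A x y : A^T = A -> form A x y = form A y x.
Proof.
move=> sA; rewrite /form -[RHS]trace_mx11 -mxtrace_tr !trmx_mul.
by rewrite trmxK sA trace_mx11 mulmxA.
Qed.

Lemma form_lin A a x y v : form A (a *: x + y) v = a * form A x v + form A y v.
Proof. by rewrite /form !mulmxDl -!scalemxAl !mxE. Qed.

Lemma form_linr A a x y v : form A v (a *: x + y) = a * form A v x + form A v y.
Proof. by rewrite /form linearP /= mulmxDr -!scalemxAr !mxE. Qed.

Lemma formE A x y : form A x y = \sum_j (\sum_i x 0 i * A i j) * y 0 j.
Proof.
by rewrite /form mxE; apply: eq_bigr => j _; rewrite !mxE.
Qed.

Lemma form_delta A x j : form A x (delta_mx 0 j) = (x *m A) 0 j.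
Proof. by rewrite /form trmx_delta -colE mxE. Qed.

Lemma form_deltal A i x : form A (delta_mx 0 i) x = (row i A *m x^T) 0 0.
Proof. by rewrite /form -rowE. Qed.

(** The discriminant argument: [A] at [a *: x + y] equals
    [2 * a * form A x y + form A y y], which is affine in [a] and so takes a
    negative value unless the slope vanishes. *)
Lemma psd_null A x y : A^T = A -> psd A -> form A x x = 0 -> form A x y = 0.
Proof.
move=> sA pA x0; apply/eqP/negP => /negP b0.
set b := form A x y in b0.
(* The scalar at which the affine function takes the value [-1]. *)
have := pA ((- (form A y y + 1) / (2 * b)) *: x + y).
rewrite form_lin !form_linr x0 (formC _ y x sA) -/b.
set c := form A y y.
have -> : - (c + 1) / (2 * b) * (- (c + 1) / (2 * b) * 0 + b)
  + (- (c + 1) / (2 * b) * b + c) = -1 by field.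
by rewrite lerNr oppr0 ler10.
Qed.

Lemma psd_diag0 A i j : A^T = A -> psd A -> A i i = 0 -> A i j = 0.
Proof.
move=> sA pA Aii; have := @psd_null A (delta_mx 0 i) (delta_mx 0 j) sA pA.
by rewrite !form_delta -!rowE !mxE; apply.
Qed.

(** One step of Cholesky elimination.  The new form at [x] is the value of the
    old one at [x] corrected along the [i]-th basis vector so as to minimise it,
    hence is nonnegative. *)
Lemma psd_peel A i : A^T = A -> psd A -> A i i != 0 ->
  psd (A - (A i i)^-1 *: ((row i A)^T *m row i A)).
Proof.
move=> sA pA c0 x.
set c := A i i in c0 *.
have rx : (row i A *m x^T) 0 0 = form A (delta_mx 0 i) x by rewrite form_deltal.
have -> : form (A - c^-1 *: ((row i A)^T *m row i A)) x x =
   form A x x - c^-1 * form A (delta_mx 0 i) x ^+ 2.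
  rewrite -rx /form mulmxBr mulmxBl -scalemxAr -scalemxAl.
  rewrite mxE; congr (_ + _); rewrite mxE; congr (- _).
  rewrite mxE; congr (_ * _).
  have xr : (x *m (row i A)^T) 0 0 = (row i A *m x^T) 0 0.
    by rewrite -[LHS]trace_mx11 -mxtrace_tr trmx_mul trmxK trace_mx11.
  rewrite expr2 -{1}xr (mulmxA x) -(mulmxA (x *m _)).
  by rewrite [X in X *m _]mx11_scalar mul_scalar_mx mxE.
have := pA ((- (form A (delta_mx 0 i) x / c)) *: delta_mx 0 i + x).
rewrite form_lin !form_linr form_delta -rowE mxE -/c (formC _ x) //.
set f := form A (delta_mx 0 i) x; set g := form A x x.
by congr (0 <= _); field.
Qed.

(** Cholesky elimination writes [Q] as a sum of positive multiples of [v^T *m v],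
    and the trace of [v^T *m v *m H] is [form H v v].  Each step clears one
    nonzero diagonal entry and creates none, and a matrix with zero diagonal is [0], so the
    induction is on the number of nonzero diagonal entries. *)
Lemma psd_trace_le0 Q H : Q^T = Q -> psd Q -> (forall v, form H v v <= 0) ->
  \tr (Q *m H) <= 0.
Proof.
move=> sQ pQ nH; have [k] := ubnP #|[pred i | Q i i != 0]|.
elim: k => // k IH in Q sQ pQ * => /ltnSE kQ.
have [/existsP[i ci]|/existsPn Q0] := boolP [exists i, Q i i != 0]; last first.
  suff -> : Q = 0 by rewrite mul0mx mxtrace0.
  apply/matrixP => i j; rewrite mxE; apply: psd_diag0 => //.
  by apply/eqP; have := Q0 i; rewrite negbK.
pose c := Q i i; pose v := row i Q.
pose Q' := Q - c^-1 *: (v^T *m v).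
have -> : Q = Q' + c^-1 *: (v^T *m v) by rewrite subrK.
rewrite mulmxDl mxtraceD -scalemxAl mxtraceZ -mulmxA (mxtrace_mulC v^T) trace_mx11.
have c0 : 0 < c.
  rewrite lt_neqAle eq_sym ci /=.
  by have := pQ (delta_mx 0 i); rewrite form_delta -rowE mxE.
rewrite -[_ + _]/(_ + c^-1 * form H v v) -[leRHS]addr0 lerD //; last first.
  by rewrite pmulr_rle0 // invr_gt0.
apply: IH.
- rewrite /Q' raddfB /= sQ; congr (_ - _).
  by rewrite linearZ /= trmx_mul trmxK.
- exact: psd_peel.
- apply: leq_trans kQ; apply: proper_card; apply/properP; split.
    apply/fintype.subsetP => j; rewrite !inE; apply: contra_neq => Qj.
    rewrite !mxE big_ord1 !mxE -/c.
    have -> : Q i j = Q j i by rewrite -[in LHS]sQ mxE.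
    by rewrite Qj (psd_diag0 Q j i sQ pQ Qj) mul0r mulr0 subrr.
  exists i; rewrite !inE ?ci // negbK !mxE big_ord1 !mxE -/c.
  by rewrite mulrA mulVf // mul1r subrr.
Qed.

Lemma continuous_form A : continuous (fun x => form A x x).
Proof.
have cA j : continuous (fun x : 'rV[R]_n => \sum_i x 0 i * A i j).
  apply: continuous_big => [|i _ x]; first exact: add_continuous.
  by apply: (@continuousM _ _ (fun x : 'rV[R]_n => x 0 i) (cst (A i j))) => //;
    [exact: coord_continuous | exact: cst_continuous].
under eq_fun do rewrite formE.
apply: continuous_big => [|j _ x]; first exact: add_continuous.
apply: (@continuousM _ _ _ (fun x : 'rV[R]_n => x 0 j)) => //;
  [exact: cA | exact: coord_continuous].
Qed.

Lemma form1E x : form 1%:M x x = \sum_i x 0 i ^+ 2.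
Proof.
by rewrite /form mulmx1 mxE; apply: eq_bigr => i _; rewrite mxE expr2.
Qed.

Lemma form1_gt0 x : x != 0 -> 0 < form 1%:M x x.
Proof.
move=> x0; rewrite form1E lt_neqAle sumr_ge0 ?andbT; last first.
  by move=> i _; exact: sqr_ge0.
apply: contra_neq x0 => /esym/eqP; rewrite psumr_eq0; last first.
  by move=> i _; exact: sqr_ge0.
move=> /allP x0; apply/matrixP => i j; rewrite ord1 mxE; apply/eqP.
by rewrite -sqrf_eq0; apply: x0; rewrite mem_index_enum.
Qed.

Lemma formZ A a x : form A (a *: x) (a *: x) = a ^+ 2 * form A x x.
Proof.
by rewrite -[a *: x]addr0 form_lin !form_linr /form !(mul0mx, trmx0, mulmx0) !mxE; ring.
Qed.

Lemma compact_sphere : compact [set x : 'rV[R]_n | form 1%:M x x = 1].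
Proof.
apply: bounded_closed_compact.
  exists 1; split=> [|M M1 x /= x1]; first exact: num_real.
  rewrite [leLHS]/Num.norm /= mx_normrE; apply/bigmax_leP; split=> [|[i j] _ /=].
    by rewrite ltW // (lt_trans ltr01).
  apply: le_trans (ltW M1); rewrite ord1 -(@ler_pXn2r _ 2) ?nnegrE //.
  rewrite expr1n real_normK ?num_real // -x1 form1E (bigD1 j) //= lerDl.
  by apply: sumr_ge0 => k _; exact: sqr_ge0.
rewrite (_ : [set x | _] = (fun x => form 1%:M x x) @^-1` [set 1]) //.
by apply: preimage_closed => [x _|]; [exact: continuous_form | exact: closed_eq].
Qed.

(** The minimum [mu] of the quadratic form on the Euclidean unit sphere is an
    eigenvalue: [A - mu *: 1%:M] is positive semidefinite and its form vanishes
    at a minimiser [z], so [psd_null] puts [z] in its kernel. *)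
Lemma eigen_psd A : A^T = A -> (forall a, eigenvalue A a -> 0 <= a) -> psd A.
Proof.
move=> sA eA x; have [->|x0] := eqVneq x 0.
  by rewrite /form !mul0mx mxE.
pose S := [set y : 'rV[R]_n | form 1%:M y y = 1].
pose nrm (y : 'rV[R]_n) := (Num.sqrt (form 1%:M y y))^-1 *: y.
have nrmS y : y != 0 -> S (nrm y).
  move=> /form1_gt0 y0; rewrite /S /= formZ exprVn sqr_sqrtr ?ltW // mulVf //.
  exact: lt0r_neq0.
have [z /set_mem zS zmin] : exists2 c, c \in S & forall y, y \in S -> form A c c <= form A y y.
  apply: compact_EVT_min; first by exists (nrm x); exact: nrmS.
  - exact: compact_sphere.
  - by apply: continuous_subspaceT; exact: continuous_form.
set mu := form A z z in zmin.
have minA y : mu * form 1%:M y y <= form A y y.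
  have [->|y0] := eqVneq y 0; first by rewrite /form !mul0mx mxE mulr0.
  have /mem_set/zmin := nrmS _ y0.
  have q0 := form1_gt0 _ y0.
  by rewrite formZ exprVn (sqr_sqrtr (ltW q0)) mulrC ler_pdivlMr.
pose B := A - mu *: 1%:M.
have formB y v : form B y v = form A y v - mu * form 1%:M y v.
  by rewrite /form mulmxBr mulmxBl -scalemxAr -scalemxAl !mxE.
have zB : z *m B = 0.
  apply/matrixP => i j; rewrite ord1 -form_delta mxE; apply: psd_null.
  - by rewrite /B raddfB /= sA linearZ /= trmx1.
  - by move=> y; rewrite formB subr_ge0.
  - by rewrite formB [form 1%:M z z]zS mulr1 subrr.
have mu0 : 0 <= mu.
  apply: eA; apply/eigenvalueP; exists z.
    by apply/eqP; rewrite -subr_eq0 -{2}[z]mulmx1 scalemxAr -mulmxBr -/B zB.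
  apply: contra_eq_neq zS => ->; rewrite /form !mul0mx mxE eq_sym; exact: oner_neq0.
by apply: le_trans (minA x); rewrite mulr_ge0 // ltW // form1_gt0.
Qed.

End QuadraticForms.

(** [inf] is [0] on sets without an infimum, so its being positive already
    certifies that the set is bounded below. *)
Lemma inf_gt0_le {R : realType} (S : set R) a : 0 < inf S -> S a -> inf S <= a.
Proof.
move=> S0; apply: ge_inf; have [[]//|/inf_out iS] := pselect (has_inf S).
by move: S0; rewrite iS ltxx.
Qed.

Lemma min_eigenvalue_psd {R : realType} {n : nat} (A : 'M[R]_n) :
  A^T = A -> 0 < min_eigenvalue A -> psd A.
Proof.
move=> sA pA; apply: eigen_psd => // a aA.
by apply: le_trans (ltW pA) _; exact: inf_gt0_le.
Qed.

(** * Derivatives along lines *)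

Lemma is_derive_lineP {R : realType} {V : normedModType R} (f : V -> R) (x v : V) (l : R) :
  is_derive x v f l <-> is_derive (0 : R) 1 (fun r : R => f (r *: v + x)) l.
Proof.
have E : (fun h : R => h^-1 *: ((f \o shift x) (h *: v) - f x)) =
   (fun h : R => h^-1 *: (((fun r : R => f (r *: v + x)) \o shift 0) (h *: 1) -
      (fun r : R => f (r *: v + x)) 0)).
  by apply/funext => h /=; rewrite addr0 scale0r add0r [_%:A]mulr1.
by split=> -[df dl]; split; move: df dl; rewrite /derive /derivable E.
Qed.

Section DirectionalDerivatives.
Context {R : realType} {V : normedModType R}.
Implicit Types (f p q : V -> R) (x y v w : V).

Lemma is_derive_line f p x v (r : R) : (forall y, is_derive y v f (p y)) ->
  is_derive r 1 (fun h : R => f (h *: v + x)) (p (r *: v + x)).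
Proof.
move=> fp; apply/(@is_derive_lineP R R^o).
have -> : (fun h : R => f ((h *: (1 : R^o) + r) *: v + x)) =
    (fun h => f (h *: v + (r *: v + x))).
  by apply/funext => h; rewrite [_%:A]mulr1 scalerDl addrA.
exact: (iffLR (is_derive_lineP _ _ _ _) (fp _)).
Qed.

Lemma is_derive_dirZ f x v (a l : R) :
  is_derive x v f l -> is_derive x (a *: v) f (a * l).
Proof.
move=> /is_derive_lineP fl; apply/is_derive_lineP.
have -> : (fun r : R => f (r *: (a *: v) + x)) =
   (fun r : R => f (r *: v + x)) \o (fun r : R => r * a).
  by apply/funext => r /=; rewrite scalerA.
rewrite mulrC; apply: is_derive1_comp; first by rewrite mul0r.
have -> : (fun r : R => r * a) = a *: (@id R).
  by apply/funext => r /=; rewrite mulrC.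
by apply: is_derive_eq; rewrite [LHS]mulr1.
Qed.

Lemma mean_value_line f q x w (h : R) : (forall y, is_derive y w f (q y)) ->
  exists xi : R, `|xi| <= `|h| /\ f (h *: w + x) - f x = h * q (xi *: w + x).
Proof.
move=> fq; pose g (r : R) := f (r *: w + x).
have dg (r : R) : is_derive r 1 g (q (r *: w + x)) by exact: is_derive_line.
have cg a b : {within `[a, b], continuous g}.
  by apply: derivable_within_continuous => r _.
have g0 : g 0 = f x by rewrite /g scale0r add0r.
have [h0|h0|->] := ltgtP h 0.
- have [xi /[!in_itv]/= /andP[xi0 xih] E] := MVT h0 (fun r _ => dg r) (cg _ _).
  exists xi; rewrite (ltr0_norm xih) (ltr0_norm h0) lerN2 (ltW xi0); split=> //.
  by rewrite -g0 -/(g h) -opprB E sub0r mulrN opprK mulrC.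
- have [xi /[!in_itv]/= /andP[xi0 xih] E] := MVT h0 (fun r _ => dg r) (cg _ _).
  exists xi; rewrite (gtr0_norm xi0) (gtr0_norm h0) (ltW xih); split=> //.
  by rewrite -g0 -/(g h) E subr0 mulrC.
- by exists 0; rewrite scale0r add0r subrr mul0r.
Qed.

(** The increment along [v + w] splits into one along [v] at [x] and one along [w]
    at a moving point.  The mean value theorem turns the second one into a value
    of [q] at a point tending to [x].  The hypothesis on [v] is at [x] alone, so
    that in an induction over coordinates [v] can be the sum already treated. *)
Lemma is_derive_dirD f p q v w x :
  is_derive x v f (p x) -> (forall y, is_derive y w f (q y)) ->
  {for x, continuous q} -> is_derive x (v + w) f (p x + q x).
Proof.
move=> fp fq cq.
have /choice[xi xiP] : forall h : R, exists xi : R, `|xi| <= `|h| /\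
   f (h *: w + (h *: v + x)) - f (h *: v + x) = h * q (xi *: w + (h *: v + x)).
  by move=> h; exact: mean_value_line.
have xi0 : xi h @[h --> 0^'] --> (0 : R).
  apply/cvgrPdist_le => e e0; near=> h; rewrite sub0r normrN.
  apply: le_trans (xiP h).1 _; near: h.
  by apply: dnbhs0_le.
have cF1 : h^-1 *: (f (h *: v + x) - f x) @[h --> 0^'] --> p x.
  by case: fp => fv <-; exact: fv.
have cF2 : q (xi h *: w + (h *: v + x)) @[h --> 0^'] --> q x.
  have cl : xi h *: w + (h *: v + x) @[h --> 0^'] --> (0 : R) *: w + ((0 : R) *: v + x).
    apply: cvgD; first by apply: cvgZ xi0 _; exact: cvg_cst.
    apply: cvgD; last exact: cvg_cst.
    by apply: cvgZ; [exact: cvg_within | exact: cvg_cst].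
  rewrite !scale0r !add0r in cl.
  exact: (cvg_comp _ _ cl cq).
have cF : h^-1 *: ((f \o shift x) (h *: (v + w)) - f x) @[h --> 0^'] --> p x + q x.
  apply: cvg_trans (cvgD cF1 cF2); apply: near_eq_cvg; near=> h.
  have h0 : h != 0 by near: h; exact: nbhs_dnbhs_neq.
  have E : q (xi h *: w + (h *: v + x)) =
      h^-1 *: (f (h *: w + (h *: v + x)) - f (h *: v + x)).
    by rewrite (xiP h).2 /GRing.scale /= mulKf.
  rewrite /= fctE E -scalerDr; congr (_ *: _).
  have -> : h *: (v + w) + x = h *: w + (h *: v + x).
    by rewrite scalerDr addrA [h *: v + _]addrC.
  by rewrite addrC subrKA.
by split; [apply/cvg_ex; eexists; exact: cF | exact: cvg_lim].
Unshelve. all: by end_near. Qed.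

End DirectionalDerivatives.

(** * First and second order conditions at a maximum *)

(** If [c] were positive, [g1 h / h] would be positive for small [h > 0], so that
    [g] would increase to the right of [0]. *)
Lemma derive_at_max_le0 {R : realType} (g g1 : R -> R) (c : R) :
  (forall r : R, is_derive r 1 g (g1 r)) -> is_derive (0 : R) 1 g1 c ->
  (forall r, g r <= g 0) -> g1 0 = 0 /\ c <= 0.
Proof.
move=> dg dg1 gmax.
have g10 : g1 0 = 0.
  have [_ <-] := dg 0.
  apply: derive_val; apply: (derive1_at_max (a := -1) (b := 1)) => //.
  by rewrite in_itv /= ltrN10 ltr01.
split=> //; rewrite leNgt; apply/negP => c0.
have cg : h^-1 * g1 h @[h --> 0^'+] --> c.
  have [g1v <-] := dg1.
  have : h^-1 *: ((g1 \o shift 0) (h *: 1) - g1 0) @[h --> 0^'] --> 'D_1 g1 (0 : R).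
    exact: g1v.
  move=> /cvg_dnbhs_at_right.
  by under eq_fun do rewrite g10 subr0 /= addr0 [_%:A]mulr1.
have : \forall h \near 0^'+, 0 < h^-1 * g1 h by apply: cvgr_gt cg _ c0.
move=> [e /= e0 eP].
have e2 : 0 < e / 2 by rewrite divr_gt0.
have cgo a b : {within `[a, b], continuous g}.
  by apply: derivable_within_continuous => r _; have [] := dg r.
have [xi /[!in_itv]/= /andP[xi0 xie] E] := MVT e2 (fun r _ => dg r) (cgo _ _).
have := gmax (e / 2); rewrite -subr_le0 E subr0 pmulr_lle0 // leNgt => /negP; apply.
have : 0 < xi^-1 * g1 xi.
  apply: eP => //=; rewrite sub0r normrN gtr0_norm //.
  by apply: lt_trans xie _; rewrite ltr_pdivrMr // ltr_pMr // ltr1n.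
by rewrite pmulr_rgt0 // invr_gt0.
Qed.

Section MaximumTest.
Context {R : realType} {d : nat}.
Implicit Types (f : 'rV[R]_d -> R) (x v : 'rV[R]_d).

(** Coordinates are added one at a time by [is_derive_dirD], with the new
    coordinate direction, whose derivative is continuous, in the role of [w]. *)
Lemma is_derive_partials f v x :
  (forall i y, derivable f y (delta_mx 0 i)) -> (forall i, continuous (partial i f)) ->
  is_derive x v f (\sum_i v 0 i * partial i f x).
Proof.
move=> df cf; rewrite [v in is_derive _ v]row_sum_delta.
elim: (index_enum _) => [|i r IH]; first by rewrite !big_nil; exact: is_derive0.
rewrite !big_cons [X in is_derive _ X]addrC [X in is_derive _ _ _ X]addrC.
apply: (is_derive_dirD f (fun=> _) (fun y => v 0 i * partial i f y)) => //.
- by move=> y; apply: is_derive_dirZ; exact: derivableP.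
- by apply: (@continuousM _ _ (cst (v 0 i)));
    [exact: cst_continuous | exact: cf].
Qed.

Lemma C2_max f x : C2 f -> (forall y, f y <= f x) ->
  (forall i, partial i f x = 0) /\ (forall v, form (hessian f x) v v <= 0).
Proof.
move=> [[df ddf] _ cf ccf] fmax.
have H v : \sum_i v 0 i * partial i f x = 0 /\ form (hessian f x) v v <= 0.
  pose g1 r := \sum_i v 0 i * partial i f (r *: v + x).
  pose g (r : R) := f (r *: v + x).
  have -> : \sum_i v 0 i * partial i f x = g1 0.
    by apply: eq_bigr => i _; rewrite scale0r add0r.
  apply: (derive_at_max_le0 g g1).
  - move=> r; apply: (is_derive_line f (fun y => \sum_i v 0 i * partial i f y)).
    by move=> y; exact: is_derive_partials.
  - have -> : g1 = \sum_i (v 0 i *: (fun r : R => partial i f (r *: v + x))).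
      by apply/funext => r; rewrite /g1 fct_sumE.
    have -> : form (hessian f x) v v =
        \sum_j v 0 j *: \sum_i v 0 i * partial i (partial j f) x.
      rewrite formE; apply: eq_bigr => j _; rewrite mulrC; congr (_ * _).
      by apply: eq_bigr => i _; rewrite mxE.
    apply: is_derive_sum => j; apply: is_deriveZ.
    apply: (iffLR (is_derive_lineP (partial j f) x v _)).
    by apply: (is_derive_partials (partial j f)) => // i; exact: ccf.
  - by move=> r; rewrite /g scale0r add0r.
split=> [i|v]; last by have [] := H v.
have [<- _] := H (delta_mx 0 i).
rewrite (bigD1 i) //= mxE !eqxx mul1r big1 ?addr0 // => j ji.
by rewrite mxE (negbTE ji) andbF mul0r.
Qed.

End MaximumTest.

(** * Linear combinations and time slices of smooth functions *)

Section SmoothFunctions.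
Context {R : realType} {d : nat}.
Implicit Types (f g : 'rV[R]_d -> R).

Lemma partial_lincomb i (c : R) f g y :
  (forall y, derivable f y (delta_mx 0 i)) ->
  (forall y, derivable g y (delta_mx 0 i)) ->
  partial i (fun x => f x - c * g x) y = partial i f y - c * partial i g y.
Proof.
move=> df dg; rewrite /partial.
have -> : (fun x => f x - c * g x) = f - (c *: g) by [].
by rewrite deriveB ?deriveZ //; exact: derivableZ.
Qed.

Lemma derivable_lincomb v (c : R) f g y :
  derivable f y v -> derivable g y v -> derivable (fun x => f x - c * g x) y v.
Proof.
move=> df dg; have -> : (fun x => f x - c * g x) = f - (c *: g) by [].
by apply: derivableB; [exact: df | exact: derivableZ].
Qed.

Lemma continuous_lincomb {T : topologicalType} (c : R) (f g : T -> R) :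
  continuous f -> continuous g -> continuous (fun x => f x - c * g x).
Proof.
move=> cf cg; have -> : (fun x => f x - c * g x) = f - (cst c * g) by [].
move=> x; apply: continuousB; first exact: cf.
by apply: continuousM; [exact: cst_continuous | exact: cg].
Qed.

Lemma partial2_lincomb i j (c : R) f g y : has_partials2 f -> has_partials2 g ->
  partial2 i j (fun x => f x - c * g x) y = partial2 i j f y - c * partial2 i j g y.
Proof.
move=> [df ddf] [dg ddg]; rewrite /partial2.
rewrite (_ : partial j _ = fun x => partial j f x - c * partial j g x).
  by rewrite partial_lincomb.
by apply/funext => x; rewrite partial_lincomb.
Qed.

Lemma hessian_lincomb (c : R) f g y : has_partials2 f -> has_partials2 g ->
  hessian (fun x => f x - c * g x) y = hessian f y - c *: hessian g y.
Proof.
by move=> hf hg; apply/matrixP => i j; rewrite !mxE partial2_lincomb.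
Qed.

Lemma C2_lincomb (c : R) f g : C2 f -> C2 g -> C2 (fun x => f x - c * g x).
Proof.
move=> [[df ddf] cf cpf cppf] [[dg ddg] cg cpg cppg].
have E i : partial i (fun x => f x - c * g x) =
    fun x => partial i f x - c * partial i g x.
  by apply/funext => x; rewrite partial_lincomb.
split; first split.
- by move=> i x; exact: derivable_lincomb.
- by move=> i j x; rewrite E; exact: derivable_lincomb.
- exact: continuous_lincomb.
- by move=> i; rewrite E; exact: continuous_lincomb.
- move=> i j; rewrite (_ : partial2 _ _ _ =
    fun x => partial2 i j f x - c * partial2 i j g x); last first.
    by apply/funext => x; rewrite partial2_lincomb.
  exact: continuous_lincomb.
Qed.

Lemma continuous_slice {U : topologicalType} (J : set R) (F : R * 'rV[R]_d -> U) t :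
  J t -> {within J `*` setT, continuous F} -> continuous (fun x => F (t, x)).
Proof.
move=> Jt /subspace_continuousP cF x.
apply: (cvg_comp (fun y => (t, y)) F (G := within (J `*` setT) (nbhs (t, x)))).
  move=> A [] /= [B1 B2] /= [tB1 xB2] BA.
  near=> y.
  apply: BA; last by split.
  by split; [exact: nbhs_singleton | near: y].
exact: cF.
Unshelve. all: by end_near. Qed.

Lemma C12_C2 (J : set R) (u : R -> 'rV[R]_d -> R) t : C12 J u -> J t -> C2 (u t).
Proof.
move=> [_ hp [cu _ cp cpp]] Jt; split; first exact: hp.
- exact: (continuous_slice _ _ _ Jt cu).
- by move=> i; exact: (continuous_slice _ _ _ Jt (cp i)).
- by move=> i j; exact: (continuous_slice _ _ _ Jt (cpp i j)).
Qed.

End SmoothFunctions.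

(** * The operator and the time derivative at a maximum *)

(** Comparison at a nonnegative maximum of [v - c *: phi] over points and
    components.  The coupling is where all components must be compared at [x]:
    off the diagonal the difference is replaced by the larger value [M], and
    [M] times a nonpositive row sum is nonpositive. *)
Lemma elliptic_op_max_le {R : realType} {d m : nat}
    (Q : 'I_m -> R -> 'rV[R]_d -> 'M[R]_d)
    (b : 'I_m -> R -> 'rV[R]_d -> 'rV[R]_d) (C : R -> 'rV[R]_d -> 'M[R]_m)
    (t c : R) (v phi : 'rV[R]_d -> 'rV[R]_m) (x : 'rV[R]_d) (k : 'I_m) :
  (Q k t x)^T = Q k t x -> psd (Q k t x) ->
  (forall h, h != k -> 0 <= C t x k h) -> \sum_(h < m) C t x k h <= 0 ->
  C2 (component k v) -> C2 (component k phi) ->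
  (forall y, v y 0 k - c * phi y 0 k <= v x 0 k - c * phi x 0 k) ->
  (forall h, v x 0 h - c * phi x 0 h <= v x 0 k - c * phi x 0 k) ->
  0 <= v x 0 k - c * phi x 0 k ->
  elliptic_op Q b C t v x 0 k <= c * elliptic_op Q b C t phi x 0 k.
Proof.
move=> sQ pQ Coff Crow Cv Cphi ymax kmax M0.
have [W1 W2] := C2_max _ _ (C2_lincomb c _ _ Cv Cphi) ymax.
have [[dv ddv] _ _ _] := Cv; have [[dp ddp] _ _ _] := Cphi.
set M := v x 0 k - c * phi x 0 k in kmax M0.
rewrite !mxE mulrDr mulrDr; apply: lerD; first apply: lerD.
- rewrite -mxtraceZ scalemxAr -subr_le0 -raddfB /= -mulmxBr.
  rewrite -hessian_lincomb; [exact: psd_trace_le0 | by case: Cv | by case: Cphi].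
- rewrite mulr_sumr le_eqVlt; apply/orP; left; apply/eqP; apply: eq_bigr => i _.
  rewrite !mxE mulrCA; congr (_ * _).
  by apply/eqP; rewrite -subr_eq0 -partial_lincomb // W1.
- rewrite mulr_sumr -subr_le0 -sumrB.
  rewrite (eq_bigr (fun h => C t x k h * (v x 0 h - c * phi x 0 h))); last first.
    by move=> h _; ring.
  apply: (@le_trans _ _ (\sum_(h < m) C t x k h * M)).
    apply: ler_sum => h _; have [->//|hk] := eqVneq h k.
    by apply: ler_wpM2l; [exact: Coff | exact: kmax].
  by rewrite -mulr_suml mulr_le0_ge0.
Qed.

(** Increments to the left only are compared, so the bound also holds at
    [t = T], where the derivative is one-sided. *)
Lemma derive_in_ge {R : realType} (s T t L : R) (f q : R -> R) :
  s < t -> t <= T -> derivable_in `]s, T] f t ->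
  (forall r, s < r < t -> f r - f t <= (r - t) * q r) ->
  q r @[r --> t^'-] --> L -> L <= derive_in `]s, T] f t.
Proof.
move=> st tT df fq qL.
have dl : (f r - f t) / (r - t) @[r --> t^'-] --> derive_in `]s, T] f t.
  move=> A /df; rewrite /= !near_simpl => AP.
  near=> r.
  have rt : r < t by near: r; exact: nbhs_left_lt.
  have sr : s < r by near: r; exact: nbhs_left_gt.
  have : (r != t) -> `]s, T]%classic r -> A ((f r - f t) / (r - t)).
    by near: r; apply: cvg_within; exact: AP.
  by apply; rewrite ?lt_eqF //= in_itv /= sr (le_trans (ltW rt)).
apply: ler_cvg_to qL dl _; near=> r.
have rt : r < t by near: r; exact: nbhs_left_lt.
have sr : s < r by near: r; exact: nbhs_left_gt.
by rewrite ler_ndivlMr ?subr_lt0 // mulrC fq // sr.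
Unshelve. all: by end_near. Qed.

(** Convexity of the exponential bounds its secant to the left of [t] by the slope
    at [r]; the form is the one that [derive_in_ge] takes. *)
Lemma expR_secant {R : realType} (mu s r t : R) :
  expR (mu * (r - s)) - expR (mu * (t - s)) <= (r - t) * (mu * expR (mu * (r - s))).
Proof.
have -> : mu * (t - s) = mu * (r - s) + mu * (t - r) by ring.
rewrite expRD -subr_ge0.
have := expR_ge1Dx (mu * (t - r)); have := expR_gt0 (mu * (r - s)).
set a := expR _; set e := expR _ => a0 ae.
have -> : (r - t) * (mu * a) - (a - a * e) = a * (e - (1 + mu * (t - r))) by ring.
by apply: mulr_ge0; [exact: ltW | rewrite subr_ge0].
Qed.

(** * Compactness *)

Lemma ler_coord_norm {R : realType} {m : nat} (v : 'rV[R]_m) k : v 0 k <= `|v|.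
Proof.
apply: le_trans (ler_norm _) _; rewrite [leRHS]/Num.norm /= mx_normrE.
exact: (le_bigmax _ (fun ij : 'I_1 * 'I_m => `|v ij.1 ij.2|) (0, k)).
Qed.

Lemma compact_cylinder {R : realType} {d : nat} (s T rho : R) :
  compact (`[s, T] `*` [set x : 'rV[R]_d | `|x| <= rho]).
Proof.
apply: compact_setX; first exact: segment_compact.
apply: bounded_closed_compact.
  exists rho; split=> [|M rM x /= xr]; first exact: num_real.
  exact: le_trans (ltW rM).
rewrite (_ : [set x | _] = Num.norm @^-1` [set r | r <= rho]) //.
by apply: preimage_closed => [x _|]; [exact: norm_continuous | exact: closed_le].
Qed.

(** * The maximum principle *)

Theorem theorem2p3 (R : realType) (d m : nat) (hd : (0 < d)%N) (hm : (0 < m)%N)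
  (I : set R) (hI : (exists a : R, I = [set t | a < t]) \/ I = setT)
  (Q : 'I_m -> R -> 'rV[R]_d -> 'M[R]_d)
  (b : 'I_m -> R -> 'rV[R]_d -> 'rV[R]_d)
  (C : R -> 'rV[R]_d -> 'M[R]_m)
  (alpha : R) (halpha : 0 < alpha < 1)
  (Qsym : forall k t x, I t -> forall i j, Q k t x i j = Q k t x j i)
  (Qhoelder : forall k i j,
    parabolic_hoelder_loc alpha I (fun t x => Q k t x i j))
  (bhoelder : forall k j,
    parabolic_hoelder_loc alpha I (fun t x => b k t x 0 j))
  (Choelder : forall h k,
    parabolic_hoelder_loc alpha I (fun t x => C t x h k))
  (Cneq0 : exists t x, I t /\ C t x <> 0)
  (Qelliptic : forall k,
    0 < inf [set min_eigenvalue (Q k z.1 z.2)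
            | z in I `*` [set: 'rV[R]_d]])
  (Cirreducible : ~ exists K : {set 'I_m},
    [/\ K <> finset.set0, K <> finset.setTfor 'I_m
      & forall i j, i \in K -> j \notin K ->
          forall t x, I t -> C t x i j = 0])
  (Lyapunov : forall J : set R, bounded_set J -> J `<=` I ->
    exists (phi : 'rV[R]_d -> 'rV[R]_m) (lambda : R),
      [/\ forall k, C2 (component k phi),
          forall x k, 0 < phi x 0 k,
          forall k, blows_up (component k phi),
          0 < lambda
        & forall t x k, J t ->
            elliptic_op Q b C t phi x 0 k <= lambda * phi x 0 k])
  (Coffdiag : forall t x h k, I t -> h != k -> 0 <= C t x h k)
  (Crowsum : forall t x h, I t -> \sum_(k < m) C t x h k <= 0)
  (s T : R) (hs : I s) (hsT : s < T)
  (u : R -> 'rV[R]_d -> 'rV[R]_m)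
  (ucont : {within `[s, T] `*` [set: 'rV[R]_d],
    continuous (fun z : R * 'rV[R]_d => u z.1 z.2)})
  (ubounded : [bounded u z.1 z.2 | z in `[s, T] `*` [set: 'rV[R]_d]])
  (uC12 : forall k, C12 `]s, T] (fun t x => u t x 0 k))
  (usub : forall t x k, t \in `]s, T] ->
    derive_in `]s, T] (fun r => u r x 0 k) t
      - elliptic_op Q b C t (u t) x 0 k <= 0)
  (uinit : forall x k, u s x 0 k <= 0) :
  forall t x k, t \in `[s, T] -> u t x 0 k <= 0.
Proof.
move=> t1 x1 k1 t1in; rewrite leNgt; apply/negP => u1.
have sTI : `[s, T] `<=` I.
  move=> t /= /[!in_itv] /= /andP[st _]; case: hI hs => [[a ->]|->] //= sa.
  exact: lt_le_trans st.
have bsT : bounded_set `[s, T]%classic.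
  exact/compact_bounded/segment_compact.
have [phi [lam [C2phi phi0 blow lam0 Lphi]]] := Lyapunov _ bsT sTI.
pose mu := lam + 1; pose E r := expR (mu * (r - s)).
have mu0 : 0 < mu by rewrite addr_gt0.
have E1 t : s <= t -> 1 <= E t.
  by move=> st; rewrite -expR0 ler_expR mulr_ge0 ?subr_ge0 // ltW.
have E0 t : 0 < E t by exact: expR_gt0.
have cE : continuous E.
  move=> r; apply: (@continuous_comp _ _ _ (fun r : R => mu * (r - s)) (@expR R)).
    apply: (@continuousM _ _ (cst mu)); first exact: cst_continuous.
    by apply: continuousB; [exact: cvg_id | exact: cst_continuous].
  exact: continuous_expR.
(* With this [eps], [w k1 t1 x1] below is half of [u t1 x1 0 k1]. *)
pose eps := u t1 x1 0 k1 / (2 * E t1 * phi x1 0 k1).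
have eps0 : 0 < eps by rewrite divr_gt0 // !mulr_gt0.
pose w k t x := u t x 0 k - eps * E t * phi x 0 k.
have w1 : 0 < w k1 t1 x1.
  have -> : w k1 t1 x1 = u t1 x1 0 k1 / 2.
    have p0 := lt0r_neq0 (phi0 x1 k1); have e0 := lt0r_neq0 (E0 t1).
    by rewrite /w /eps; field; rewrite p0 e0.
  exact: divr_gt0.
have [B uB] : exists B, forall t x k, t \in `[s, T] -> u t x 0 k <= B.
  have [M [_ HM]] := ubounded; exists (M + 1) => t x k tin.
  apply: le_trans (ler_coord_norm _ _) _.
  by apply: (HM (M + 1) _ (t, x)) => //; rewrite ltrDl.
have /choice[rad radP] : forall k, exists r, forall x, r <= `|x| -> B / eps <= phi x 0 k.
  by move=> k; exact: blow.
(* A common radius for all components, large enough for the cylinder to contain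
   [x1]. *)
pose rho := `|x1| + \sum_k `|rad k|.
have wout k t x : t \in `[s, T] -> rho < `|x| -> w k t x <= 0.
  move=> tin rx; rewrite subr_le0; apply: le_trans (uB _ _ _ tin) _.
  have Bphi : B / eps <= phi x 0 k.
    apply: radP; apply: le_trans (ltW rx); apply: le_trans (ler_norm _) _.
    by rewrite /rho (bigD1 k) //= addrCA lerDl addr_ge0 // sumr_ge0.
  rewrite ler_pdivrMr // mulrC in Bphi; apply: le_trans Bphi _.
  rewrite -mulrA ler_pM2l //; apply: ler_peMl; first exact: ltW.
  by apply: E1; move: tin; rewrite in_itv => /andP[].
pose K := `[s, T]%classic `*` [set x : 'rV[R]_d | `|x| <= rho].
have K1 : K (t1, x1) by split=> //=; rewrite lerDl sumr_ge0.
have wcont k : {within K, continuous (fun z => w k z.1 z.2)}.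
  apply: (@continuous_subspaceW _ _ _ (`[s, T]%classic `*` setT)).
    by move=> z [? _].
  have c1 : {within `[s, T] `*` [set: 'rV[R]_d], continuous (fun z => u z.1 z.2 0 k)}.
    have ck : {in (fun z => u z.1 z.2) @` (`[s, T] `*` [set: 'rV[R]_d]),
        continuous (fun v : 'rV[R]_m => v 0 k)}.
      by move=> v _; exact: coord_continuous.
    exact: (@within_continuous_comp _ _ _ _ _ _ ck ucont).
  have c2 : continuous (fun z : R * 'rV[R]_d => eps * E z.1 * phi z.2 0 k).
    have cE1 : continuous (fun z : R * 'rV[R]_d => E z.1).
      by move=> z; apply: (continuous_comp _ (cE _)); exact: cvg_fst.
    have cphi : continuous (fun z : R * 'rV[R]_d => phi z.2 0 k).
      have [_ cp _ _] := C2phi k.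
      by move=> z; apply: (continuous_comp _ (cp _)); exact: cvg_snd.
    move=> z; apply: (@continuousM _ _ (fun z => eps * E z.1)); last exact: cphi.
    by apply: (@continuousM _ _ (cst eps)); [exact: cst_continuous | exact: cE1].
  exact: (within_continuousB c1 (continuous_subspaceT c2)).
have /choice[zm zmP] : forall k, exists z, K z /\ forall z', K z' -> w k z'.1 z'.2 <= w k z.1 z.2.
  move=> k; have [|||z /set_mem Kz zmax] := @compact_EVT_max _ _ (fun z => w k z.1 z.2) K.
  - by exists (t1, x1).
  - exact: compact_cylinder.
  - exact: wcont.
  - by exists z; split=> // z' /mem_set; exact: zmax.
have [k _ kmax] := @arg_maxP _ _ 'I_m k1 xpredT (fun k => w k (zm k).1 (zm k).2) isT.
have [[t0in x0in] zmax] := zmP k.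
move: t0in x0in zmax kmax; set t := (zm k).1; set x := (zm k).2.
move=> /= tin xin zmax kmax.
have wpos : 0 < w k t x.
  apply: lt_le_trans w1 _; apply: le_trans (kmax k1 isT).
  exact: ((zmP k1).2 (t1, x1)).
have wmax h r y : r \in `[s, T] -> w h r y <= w k t x.
  move=> rin; have [yr|ry] := leP `|y| rho; last first.
    exact: le_trans (wout _ _ _ rin ry) (ltW wpos).
  apply: le_trans (kmax h isT).
  by apply: ((zmP h).2 (r, y)); split.
have [st tT] : s < t /\ t <= T.
  move: tin; rewrite in_itv /= => /andP[]; rewrite le_eqVlt => /orP[/eqP st|//] _.
  move: wpos; rewrite /w -st subr_gt0 ltNge => /negP[].
  by apply: le_trans (uinit x k) _; apply: mulr_ge0; [apply: mulr_ge0; exact: ltW | exact: ltW].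
have tin' : t \in `]s, T] by rewrite in_itv /= st.
have It : I t by apply: sTI.
have ell : elliptic_op Q b C t (u t) x 0 k <=
    (eps * E t) * elliptic_op Q b C t phi x 0 k.
  apply: elliptic_op_max_le => //.
  - by apply/matrixP => i j; rewrite mxE; apply: Qsym.
  - apply: min_eigenvalue_psd; first by apply/matrixP => i j; rewrite mxE; apply: Qsym.
    by apply: lt_le_trans (Qelliptic k) _; apply: inf_gt0_le => //; exists (t, x).
  - by move=> h hk; apply: Coffdiag => //; rewrite eq_sym.
  - exact: Crowsum.
  - exact: (C12_C2 _ _ _ (uC12 k)).
  - by move=> y; exact: wmax.
  - by move=> h; exact: wmax.
  - exact: ltW.
have Lp := Lphi t x k tin.
have [du _ _] := uC12 k.
have tder : eps * phi x 0 k * (mu * E t) <= derive_in `]s, T] (fun r => u r x 0 k) t.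
  apply: (derive_in_ge _ _ _ _ _ (fun r => eps * phi x 0 k * (mu * E r)) st tT).
  - exact: du.
  - move=> r /andP[sr rt].
    have := wmax k r x; rewrite in_itv /= (ltW sr) (le_trans (ltW rt) tT) /w => /(_ isT).
    have := expR_secant mu s r t; rewrite -/(E r) -/(E t).
    have p0 : 0 < eps * phi x 0 k by rewrite mulr_gt0.
    move=> /(ler_wpM2l (ltW p0)); rewrite mulrBr => Ers wr.
    rewrite mulrCA; apply: le_trans Ers.
    lra.
  - apply: cvgM; first exact: cvg_cst.
    apply: cvgM; first exact: cvg_cst.
    by apply: cvg_at_left_filter; exact: cE.
have := usub t x k tin'; rewrite subr_le0 => /(le_trans tder)/le_trans/(_ ell).
rewrite leNgt => /negP; apply.
have p0 : 0 < eps * E t by rewrite mulr_gt0.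
rewrite -(ler_pM2l p0) in Lp; apply: le_lt_trans Lp _.
have -> : eps * phi x 0 k * (mu * E t) =
    eps * E t * (lam * phi x 0 k) + eps * E t * phi x 0 k by rewrite /mu; ring.
by rewrite ltrDl mulr_gt0.
Qed.
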